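(* Let $(\mathcal{M},\pi)$ be the colored pattern matrix associated with $\mathcal{M}\in\{0,\ast,?\}^{p\times q}$ ($p\leq q$) and $\pi=\{\mathcal{I}^\ast_1,\ldots,\mathcal{I}^\ast_k,\mathcal{I}^?_1,\ldots,\mathcal{I}^?_l\}$. Then $(\mathcal{M},\pi)$ has full row rank (i.e. every real matrix in $\mathcal{P}(\mathcal{M},\pi)$ has full row rank) if its associated colored graph $\mathcal{G}(\mathcal{M},\pi)$ is colorable.
   Context: A pattern matrix is a matrix with entries in the set of symbols $\{0,\ast,?\}$. Let $\mathcal{M}\in\{0,\ast,?\}^{p\times q}$ with $p\le q$. Let $\mathcal{I}_{\mathcal M}(\ast)$ and $\mathcal{I}_{\mathcal M}(?)$ be the sets of locations $(i,j)$ with $\mathcal{M}_{ij}=\ast$, respectively $\mathcal{M}_{ij}=?$. A coloring of $\mathcal{M}$ is $\pi=\{\mathcal{I}^\ast_1,\ldots,\mathcal{I}^\ast_k,\mathcal{I}^?_1,\ldots,\mathcal{I}^?_l\}$, where $\{\mathcal{I}^\ast_1,\ldots,\mathcal{I}^\ast_k\}$ is a partition of $\mathcal{I}_{\mathcal M}(\ast)$ and $\{\mathcal{I}^?_1,\ldots,\mathcal{I}^?_l\}$ is a partition of $\mathcal{I}_{\mathcal M}(?)$; $(\mathcal{M},\pi)$ is called a colored pattern matrix. The colored pattern class $\mathcal{P}(\mathcal{M},\pi)$ is the set of all $M\in\mathbb{R}^{p\times q}$ such that $M_{ij}=0$ if $\mathcal{M}_{ij}=0$; $M_{ij}\ne 0$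 if $\mathcal{M}_{ij}=\ast$ (entries with $\mathcal{M}_{ij}=?$ may be zero or nonzero); and $M_{ij}=M_{mn}$ whenever $(i,j),(m,n)$ belong to the same set $\mathcal{I}^\ast_r$ or to the same set $\mathcal{I}^?_s$. Colored graph: $\mathcal{G}(\mathcal{M},\pi)=(V,E,\pi_E)$ is the directed graph with $V=\{1,\ldots,q\}$ and $E=\{(i,j)\in V\times V\mid \mathcal{M}_{ji}=\ast\text{ or }\mathcal{M}_{ji}=?\}$. The edges $(i,j)$ with $(j,i)\in\mathcal{I}^\ast_r$ form the set $E^\ast_r$, are solid, and have color $c_r$; the edges with $(j,i)\in\mathcal{I}^?_s$ form the set $E^?_s$, are dashed, and have color $g_s$; all colors $c_1,\ldots,c_k,g_1,\ldots,g_l$ are distinct symbols, and $\pi_E=\{E^\ast_1,\ldots,E^\ast_k,E^?_1,\ldots,E^?_l\}$. Associated bipartite graph: for nonempty $X,Y\subseteq V$ with $|X|=|Y|$ (regarded as disjoint copies, since $X$ and $Y$ may share vertices of $V$), the colored bipartite graph $G=(X,Y,E_{XY},\pi_{XY})$ has edges $\{x,y\}$ for all $x\in X$, $y\in Y$ with $(x,y)\in E$, each edge inheriting its color and type (solid/dashed) from $(x,y)$; $E^\ast_{XY}$ denotes the set of solid edges. With enumerations $X=\{x_1,\ldots,x_t\}$, $Y=\{y_1,\ldots,y_t\}$, a perfect matching has the form $m=\{\{x_1,y_{\gamma(1)}\},\ldots,\{x_t,y_{\gamma(t)}\}\}$ with all these pairs in $E_{XY}$ and $\gamma$ a permutation;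 its sign is the sign of $\gamma$; its spectrum is the multiset of colors of its edges. Two perfect matchings are equivalent if they have the same spectrum; the spectrum of an equivalence class is the common spectrum of its members, and its signature is the sum of the signs of its members. Color-perfect white neighbor: suppose each vertex of $V$ is colored black or white. For nonempty $X,Y\subseteq V$, $Y$ is a color-perfect white neighbor of $X$ if (1) $|Y|=|X|$; (2) $Y=\{y\in V\mid y\text{ is white and }(x,y)\in E\text{ for some }x\in X\}$; (3) in the associated bipartite graph $(X,Y,E_{XY},\pi_{XY})$ there exists a perfect matching, exactly one equivalence class of perfect matchings has a nonzero signature, and the spectrum of this equivalence class contains only colors corresponding to edges in $E^\ast_{XY}$ (solid edges). Color change rule: (i) initially all vertices in $V$ are white; (ii) if there exist $Y\subseteq\{1,\ldots,p\}$ and $X\subseteq\{1,\ldots,q\}$ such that $Y$ is a color-perfect white neighbor of $X$ (with respect to the current colors), change the color of all vertices in $Y$ to black; (iii) repeat step (ii) until no further color changes are possible. A derived set $\mathcal{D}$ is a set of black vertices obtained by following this procedure (it may depend on the choices made). $\mathcal{G}(\mathcal{M},\pi)$ is called colorable if there exists a derived set $\mathcal{D}=\{1,\ldots,p\}$. *)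

(* Defs.v *)
(* MathComp, with the real numbers of MathComp-Analysis. *)
From HB Require Import structures.
From mathcomp Require Import all_boot all_order all_algebra all_fingroup.
From mathcomp Require Import finmap multiset reals.

Set Implicit Arguments.
Unset Strict Implicit.
Unset Printing Implicit Defensive.

Import GRing.Theory.
Local Open Scope ring_scope.

(* Any is the symbol "?". *)
Inductive symbol := Zero | Star | Any.

Definition symbol_eq (a b : symbol) : bool :=
  match a, b with
  | Zero, Zero | Star, Star | Any, Any => true
  | _, _ => false
  end.

Lemma symbol_eqP : Equality.axiom symbol_eq.
Proof. by case=> [] []; constructor. Qed.

HB.instance Definition _ := hasDecEq.Build symbol symbol_eqP.

Definition locations (p q : nat) (M : 'M[symbol]_(p, q)) (s : symbol) :
    {set 'I_p * 'I_q} :=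
  [set a | M a.1 a.2 == s].

Record coloring (p q : nat) (M : 'M[symbol]_(p, q)) := Coloring {
  star_blocks : {set {set 'I_p * 'I_q}};
  any_blocks : {set {set 'I_p * 'I_q}};
  star_blocksP : partition star_blocks (locations M Star);
  any_blocksP : partition any_blocks (locations M Any) }.

Definition pattern_class (R : realType) (p q : nat) (M : 'M[symbol]_(p, q))
    (pi : coloring M) (A : 'M[R]_(p, q)) : Prop :=
  [/\ forall i j, M i j = Zero -> A i j = 0,
      forall i j, M i j = Star -> A i j != 0
    & forall B, B \in star_blocks pi :|: any_blocks pi ->
        forall a b, a \in B -> b \in B -> A a.1 a.2 = A b.1 b.2].

Definition full_row_rank (R : realType) (p q : nat) (M : 'M[symbol]_(p, q))
    (pi : coloring M) : Prop :=
  forall A : 'M[R]_(p, q), pattern_class pi A -> row_free A.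

(* A color is represented by the set of all edges bearing it. *)
Record colored_graph (V : finType) := ColoredGraph {
  edges : {set V * V};
  solid_classes : {set {set V * V}};
  dashed_classes : {set {set V * V}} }.

(* The entry in row r and column c gives the edge c -> r; the row index becomes
   a vertex through the inclusion of {1, ..., p} in {1, ..., q}. *)
Definition edge_of (p q : nat) (hpq : (p <= q)%N) (a : 'I_p * 'I_q) :
    'I_q * 'I_q :=
  (a.2, widen_ord hpq a.1).

Definition graph_of (p q : nat) (hpq : (p <= q)%N) (M : 'M[symbol]_(p, q))
    (pi : coloring M) : colored_graph 'I_q :=
  {| edges := edge_of hpq @: (locations M Star :|: locations M Any);
     solid_classes :=
       [set edge_of hpq @: (B : {set 'I_p * 'I_q}) | B in star_blocks pi];
     dashed_classes :=
       [set edge_of hpq @: (B : {set 'I_p * 'I_q}) | B in any_blocks pi] |}.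

Definition solid_edges (V : finType) (G : colored_graph V) : {set V * V} :=
  cover (solid_classes G).

Definition edge_color (V : finType) (G : colored_graph V) (e : V * V) :
    {set V * V} :=
  pblock (solid_classes G :|: dashed_classes G) e.

(* Below, xs and ys enumerate the two sides of the associated bipartite graph;
   the permutation s stands for the matching {x_i, y_(s i)}, i < t. *)
Definition perfect_matchings (V : finType) (G : colored_graph V) (t : nat)
    (xs ys : t.-tuple V) : {set 'S_t} :=
  [set s : 'S_t | [forall i, (tnth xs i, tnth ys (s i)) \in edges G]].

Definition spectrum (V : finType) (G : colored_graph V) (t : nat)
    (xs ys : t.-tuple V) (s : 'S_t) : {mset {set V * V}}%mset :=
  seq_mset [seq edge_color G (tnth xs i, tnth ys (s i)) | i <- enum 'I_t].

Definition matching_classes (V : finType) (G : colored_graph V) (t : nat)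
    (xs ys : t.-tuple V) : {set {set 'S_t}} :=
  equivalence_partition
    [rel s s' | spectrum G xs ys s == spectrum G xs ys s']
    (perfect_matchings G xs ys).

Definition signature (t : nat) (C : {set 'S_t}) : int :=
  \sum_(s in C) (-1) ^+ (s : bool).

Definition color_perfect (V : finType) (G : colored_graph V) (t : nat)
    (xs ys : t.-tuple V) : Prop :=
  perfect_matchings G xs ys != set0 /\
  exists C : {set 'S_t},
    [set C' in matching_classes G xs ys | signature C' != 0] = [set C] /\
    forall s c, s \in C -> c \in spectrum G xs ys s ->
      exists x y, [/\ x \in xs, y \in ys, (x, y) \in solid_edges G
                    & edge_color G (x, y) = c].

(* black is the set of black vertices.  Changing the enumerations multiplies
   all signatures by a common sign, so their choice is immaterial. *)
Definition color_perfect_white_neighbor (V : finType) (G : colored_graph V)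
    (black X Y : {set V}) : Prop :=
  [/\ X != set0, Y != set0, #|Y| = #|X|,
      Y = [set y | (y \notin black) && [exists x in X, (x, y) \in edges G]]
    & exists t (xs ys : t.-tuple V),
        [/\ uniq xs, uniq ys, X = [set x in xs], Y = [set y in ys]
          & color_perfect G xs ys]].

Definition first_vertices (p q : nat) : {set 'I_q} := [set v : 'I_q | (v < p)%N].

Inductive reachable (p q : nat) (G : colored_graph 'I_q) :
    {set 'I_q} -> Prop :=
| reachable_init : reachable p G set0
| reachable_step (black X Y : {set 'I_q}) :
    reachable p G black -> Y \subset first_vertices p q ->
    color_perfect_white_neighbor G black X Y ->
    reachable p G (black :|: Y).

Definition derived_set (p q : nat) (G : colored_graph 'I_q) (D : {set 'I_q}) :
    Prop :=
  reachable p G D /\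
  forall X Y : {set 'I_q}, Y \subset first_vertices p q ->
    ~ color_perfect_white_neighbor G D X Y.

Definition colorable (p q : nat) (G : colored_graph 'I_q) : Prop :=
  derived_set p G (first_vertices p q).

(* Main.v *)
Require Import Defs.
From mathcomp Require Import all_boot all_order all_algebra all_fingroup.
From mathcomp Require Import finmap multiset reals.

(** Let [u *m A = 0] with [A] in the pattern class. By induction along the color
    change rule, [u] vanishes on every black vertex. When [Y] is a color-perfect
    white neighbor of [X], the equations of [u *m A = 0] indexed by [X] involve
    only the unknowns indexed by [Y]. Grouping the Leibniz expansion of the
    determinant of this square system by equivalence classes of matchings, only
    one class contributes: its signature times a product of entries at solid
    edges. Hence the system is regular and [u] vanishes on [Y]. *)

Set Implicit Arguments.
Unset Strict Implicit.
Unset Printing Implicit Defensive.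

Import GRing.Theory Num.Theory.
Local Open Scope ring_scope.

Section ColoredWeight.
Variables (F : numFieldType) (V : finType) (G : colored_graph V).
(** [w] abstracts a matrix of the pattern class: [w (x, y)] stands for its entry in row [y] and
    column [x]. *)
Variable w : V * V -> F.

Let classes := solid_classes G :|: dashed_classes G.

Hypothesis edgesE : edges G = cover classes.
Hypothesis weight_nonedge : forall e, e \notin edges G -> w e = 0.
Hypothesis weight_class : forall B, B \in classes -> {in B &, forall e f, w e = w f}.
Hypothesis weight_solid : forall e, e \in solid_edges G -> w e != 0.

Lemma solid_edges_sub : solid_edges G \subset edges G.
Proof.
rewrite edgesE; apply/bigcupsP => B sB.
by apply: bigcup_sup; rewrite inE sB.
Qed.

(** A color is a [pblock]; since the classes cover the edges, the block of an edge is a class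
    containing it, so [e] and [f] lie in a common class. *)
Lemma weight_edge_color e f :
  e \in edges G -> f \in edges G -> edge_color G e = edge_color G f -> w e = w f.
Proof.
rewrite edgesE => eE fE cef.
apply: (weight_class (pblock_mem eE)); first by rewrite mem_pblock.
by rewrite -/(edge_color G e) cef mem_pblock.
Qed.

(** A spectrum remembers colors only, so weights must be read off colors; the default 0 is reached
    only for sets that color no edge. *)
Definition color_weight (c : {set V * V}) : F :=
  if [pick e in edges G | edge_color G e == c] is Some e then w e else 0.

Lemma color_weightE e : e \in edges G -> color_weight (edge_color G e) = w e.
Proof.
move=> eE; rewrite /color_weight; case: pickP => [f /andP[fE /eqP cf]|/(_ e)].
  exact: weight_edge_color.
by rewrite eE eqxx.
Qed.

Section Matchings.
Variables (t : nat) (xs ys : t.-tuple V).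

Definition weight_mx : 'M[F]_t := \matrix_(i, j) w (tnth xs i, tnth ys j).

Let term (s : 'S_t) := \prod_i weight_mx i (s i).

Lemma perfect_matching_edge s i :
  s \in perfect_matchings G xs ys -> (tnth xs i, tnth ys (s i)) \in edges G.
Proof. by rewrite inE => /forallP. Qed.

Lemma term_nonmatching s : s \notin perfect_matchings G xs ys -> term s = 0.
Proof.
rewrite inE negb_forall => /existsP[i si]; apply/eqP/prodf_eq0.
by exists i => //; rewrite mxE weight_nonedge.
Qed.

(** This makes Leibniz terms constant on each equivalence class of matchings. *)
Lemma term_spectrum s : s \in perfect_matchings G xs ys ->
  term s = \prod_(c <- spectrum G xs ys s) color_weight c.
Proof.
move=> sP; rewrite (perm_big _ (perm_eq_seq_mset _)) big_map big_enum.
apply: eq_bigr => i _; rewrite mxE color_weightE //.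
exact: perfect_matching_edge.
Qed.

Lemma matching_classes_partition :
  partition (matching_classes G xs ys) (perfect_matchings G xs ys).
Proof.
apply: equivalence_partitionP => s1 s2 s3 _ _ _ /=.
by split=> // /eqP->.
Qed.

Lemma matching_class_sub C s : C \in matching_classes G xs ys -> s \in C ->
  s \in perfect_matchings G xs ys.
Proof.
move=> CP sC; rewrite -(cover_partition matching_classes_partition).
by apply/bigcupP; exists C.
Qed.

Lemma matching_class_spectrum C : C \in matching_classes G xs ys ->
  {in C &, forall s s', spectrum G xs ys s = spectrum G xs ys s'}.
Proof.
move=> CP s s' sC s'C; apply/eqP.
have eqvR : {in perfect_matchings G xs ys & &, equivalence_rel
    [rel s s' | spectrum G xs ys s == spectrum G xs ys s']}.
  by move=> s1 s2 s3 _ _ _ /=; split=> // /eqP->.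
have := pblock_equivalence_partition eqvR (matching_class_sub CP sC)
  (matching_class_sub CP s'C) => /= <-.
have /and3P[_ tI _] := matching_classes_partition.
by rewrite (def_pblock tI CP sC).
Qed.

Lemma sum_matching_class C s : C \in matching_classes G xs ys -> s \in C ->
  \sum_(s' in C) (-1) ^+ (s' : bool) * term s' = (signature C)%:~R * term s.
Proof.
move=> CP sC; rewrite /signature rmorph_sum mulr_suml; apply: eq_bigr => s' s'C.
rewrite rmorphXn rmorphN1; congr (_ * _).
rewrite !term_spectrum ?(matching_class_sub CP) //.
by rewrite (matching_class_spectrum CP s'C sC).
Qed.

(** A permutation that is not a perfect matching uses a non-edge, so only matchings survive in the
    Leibniz expansion. *)
Lemma det_weight_mx_classes : \det weight_mx =
  \sum_(C in matching_classes G xs ys)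
    \sum_(s in C) (-1) ^+ (s : bool) * term s.
Proof.
rewrite -(set_partition_big _ matching_classes_partition) [RHS]big_mkcond.
apply: eq_bigr => s _; case: ifPn => // /term_nonmatching.
by rewrite /term => ->; rewrite mulr0.
Qed.

Lemma color_perfect_unitmx : color_perfect G xs ys -> weight_mx \in unitmx.
Proof.
case=> _ [C [/setP unique_class solidC]].
have /[!(inE, eqxx)]/andP[CP sigC] := unique_class C.
have [s sC] : exists s, s \in C.
  apply/set0Pn; apply: contraNneq sigC => ->.
  by rewrite /signature big_set0.
rewrite unitmxE unitfE det_weight_mx_classes (bigD1 C) //= [X in _ + X]big1.
  (* The signature stays nonzero in [F], which has characteristic zero. *)
  rewrite addr0 (sum_matching_class CP sC) mulf_neq0 ?intr_eq0 //.
  apply/prodf_neq0 => i _; rewrite mxE.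
  have sE := perfect_matching_edge i (matching_class_sub CP sC).
  (* The matching edge has the color of some solid edge, hence the same nonzero weight. *)
  have [|x [y [_ _ xyE /esym cE]]] := solidC s (edge_color G (tnth xs i, tnth ys (s i))) sC.
    rewrite (perm_mem (perm_eq_seq_mset _)).
    by apply/mapP; exists i; rewrite ?mem_enum.
  rewrite (weight_edge_color sE _ cE) ?weight_solid //.
  exact: (subsetP solid_edges_sub).
move=> C' /andP[C'P C'C].
have sig0 : signature C' = 0.
  apply/eqP; apply: contraNT C'C => sigC'.
  by have := unique_class C'; rewrite !inE C'P sigC' => /esym.
have [->|/set0Pn[s' s'C]] := eqVneq C' set0; first by rewrite big_set0.
by rewrite (sum_matching_class C'P s'C) sig0 mul0r.
Qed.
End Matchings.

Variable f : V -> F.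
Hypothesis f_ker : forall x, \sum_y w (x, y) * f y = 0.

Lemma white_neighbor_ker (black X Y : {set V}) :
  color_perfect_white_neighbor G black X Y ->
  {in black, forall y, f y = 0} -> {in Y, forall y, f y = 0}.
Proof.
case=> _ _ _ defY [t [xs [ys [uxs uys defX YE cp]]]] f0.
have ker0 : weight_mx xs ys *m (\col_j f (tnth ys j)) = 0.
  apply/colP => i; rewrite !mxE -[RHS](f_ker (tnth xs i)).
  rewrite (bigID [in Y]) /= [X in _ = _ + X]big1 ?addr0.
    under [RHS]eq_bigl do rewrite YE inE.
    rewrite -(big_uniq _ uys) big_tuple.
    by apply: eq_bigr => j _; rewrite !mxE.
  (* A vertex outside [Y] is either black, where [f] vanishes, or no out-neighbor of any vertex of
     [X], where the weight vanishes. *)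
  move=> y; rewrite [in y \in Y]defY inE negb_and negbK.
  case/orP=> [/f0->|]; first by rewrite mulr0.
  rewrite negb_exists => /forallP/(_ (tnth xs i)).
  by rewrite defX inE mem_tnth => /weight_nonedge->; rewrite mul0r.
have /colP col0 := congr1 (mulmx (invmx (weight_mx xs ys))) ker0.
move=> y; rewrite YE inE => /tnthP[j ->].
by move: (col0 j); rewrite mulKmx ?color_perfect_unitmx // mulmx0 !mxE.
Qed.

End ColoredWeight.

Lemma reachable_ker (F : numFieldType) (p q : nat) (G : colored_graph 'I_q)
    (w : 'I_q * 'I_q -> F) (f : 'I_q -> F) (black : {set 'I_q}) :
  edges G = cover (solid_classes G :|: dashed_classes G) ->
  (forall e, e \notin edges G -> w e = 0) ->
  (forall B, B \in solid_classes G :|: dashed_classes G ->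
     {in B &, forall e e', w e = w e'}) ->
  (forall e, e \in solid_edges G -> w e != 0) ->
  (forall x, \sum_y w (x, y) * f y = 0) ->
  reachable p G black -> {in black, forall y, f y = 0}.
Proof.
move=> edgesE w0 wB wS f_ker; elim=> [y|{}black X Y _ IH _ nbr y].
  by rewrite inE.
rewrite inE => /orP[/IH//|].
exact: (white_neighbor_ker edgesE w0 wB wS f_ker nbr IH).
Qed.

Lemma cover_imset_imset (T T' : finType) (h : T -> T') (P : {set {set T}}) :
  cover [set h @: (B : {set T}) | B in P] = h @: cover P.
Proof. by rewrite cover_imset imset_cover. Qed.

Section GraphOf.
Variables (R : realType) (p q : nat) (hpq : (p <= q)%N).
Variables (M : 'M[symbol]_(p, q)) (pi : coloring M).

Lemma cover_star_blocks : cover (star_blocks pi) = locations M Star.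
Proof. exact: cover_partition (star_blocksP pi). Qed.

Lemma cover_any_blocks : cover (any_blocks pi) = locations M Any.
Proof. exact: cover_partition (any_blocksP pi). Qed.

(** Direct images commute with unions, and the blocks of each kind cover the locations of their
    symbol. *)
Lemma edges_graph_of (G := graph_of hpq pi) :
  edges G = cover (solid_classes G :|: dashed_classes G).
Proof.
rewrite /G /= imsetU -cover_star_blocks -cover_any_blocks -!cover_imset_imset.
by rewrite /cover bigcup_setU.
Qed.

(* At most one term; the sum is empty when [e.2] is not a row index. *)
Definition entry_at (A : 'M[R]_(p, q)) (e : 'I_q * 'I_q) : R :=
  \sum_(i | widen_ord hpq i == e.2) A i e.1.

Lemma entry_at_edge (A : 'M[R]_(p, q)) a :
  entry_at A (edge_of hpq a) = A a.1 a.2.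
Proof. by rewrite /entry_at (big_pred1 a.1). Qed.

End GraphOf.

Theorem theorem15 (R : realType) (p q : nat) (hpq : (p <= q)%N)
    (M : 'M[symbol]_(p, q)) (pi : coloring M) :
  colorable p (graph_of hpq pi) -> full_row_rank R pi.
Proof.
move=> [reach _] A [A0 AS AB]; apply: inj_row_free => u uA0.
(* [f] extends [u] by zero to the vertices that are not row indices. *)
pose f (y : 'I_q) := \sum_(i | widen_ord hpq i == y) u 0 i.
have fE i : f (widen_ord hpq i) = u 0 i.
  by rewrite /f (big_pred1 i).
suff f0 : {in first_vertices p q, forall y, f y = 0}.
  by apply/rowP => i; rewrite mxE -fE f0 // inE /= ltn_ord.
apply: (@reachable_ker _ _ _ _ (entry_at hpq A) _ _ (edges_graph_of _ _)) reach.
- case=> x y eE; rewrite /entry_at big1 //= => i /eqP iy; apply: A0.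
  (* A location whose symbol is not [Zero] would yield the edge [(x, y)]. *)
  apply/eqP; apply: contraNT eE => Mix.
  apply/imsetP; exists (i, x); last by rewrite /edge_of iy.
  by rewrite !inE /=; case: (M i x) Mix.
- move=> B /setUP[] /imsetP[B' B'P ->] e e' /imsetP[a aB ->] /imsetP[b bB ->];
    rewrite !entry_at_edge; apply: (AB B') => //; by rewrite inE B'P ?orbT.
- move=> e; rewrite /solid_edges /= cover_imset_imset cover_star_blocks.
  by case/imsetP=> a /[!inE]/eqP Ma ->; rewrite entry_at_edge AS.
(* Column [x] of [u *m A = 0], with rows grouped by their vertex; the group of a vertex that is not
   a row index is empty. *)
- move=> x; have /rowP/(_ x) := uA0; rewrite !mxE => sum0.
  rewrite -[RHS]sum0 (partition_big (widen_ord hpq) xpredT) //=.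
  apply: eq_bigr => y _; rewrite /entry_at mulr_suml.
  by apply: eq_bigr => i /eqP /= <-; rewrite fE mulrC.
Qed.
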